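(* Let $L\subseteq\mathbb{Z}^2$ be a set of lattice points containing no three collinear points, and suppose $$\liminf_{n\to\infty}\frac{|L\cap[1,n]^2|}{2n}=H>0.$$ Then for any sublinear limiter function $k$ there exists a set of lattice points $S\subseteq\mathbb{Z}^2$ such that, for every $n\in\mathbb{N}^+$, each line contains at most $k(n)$ points of $S\cap[1,n]^2$, and $$\liminf_{n\to\infty}\frac{|S\cap[1,n]^2|}{n\,k(n)}\ge\frac{H^2}{4}.$$
   Context: $\mathbb{N}^+$ denotes the positive integers. $[1,n]^2$ denotes the set of lattice points $(x,y)\in\mathbb{Z}^2$ with $1\le x\le n$ and $1\le y\le n$. ''Line'' means any straight line in $\mathbb{R}^2$. A function $k:\mathbb{N}^+\to\mathbb{R}_{\ge 0}$ (with the convention $k(0)=0$) is called a sublinear limiter function if it satisfies all of the following: (1) $k(n)=o(n)$; (2) $k$ is unbounded; (3) $k$ is monotonically increasing (in the weak sense, i.e. non-decreasing); (4) $\displaystyle\liminf_{n\to\infty}\frac{\sum_{i=1}^{n}2k(i)}{n\,k(n)}\ge 1$; (5) $\displaystyle\liminf_{n\to\infty}\frac{k(\lfloor\lambda n\rfloor)}{k(n)}\ge\lambda$ for all $\lambda\in[0,1]$. (By (2) and (3), $k(n)>0$ for all sufficiently large $n$, so the limits inferior make sense.) *)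

(* Defs.v *)
From HB Require Import structures.
From mathcomp Require Import all_boot all_order all_algebra.
From mathcomp Require Import finmap.
From mathcomp Require Import all_classical all_reals all_analysis.

Set Implicit Arguments.
Unset Strict Implicit.
Unset Printing Implicit Defensive.

Import Order.TTheory GRing.Theory Num.Theory.
Import numFieldNormedType.Exports.
Local Open Scope classical_set_scope.
Local Open Scope ring_scope.

Definition box (n : nat) : set (int * int) :=
  [set p | [/\ 1 <= p.1, p.1 <= n%:Z, 1 <= p.2 & p.2 <= n%:Z]].

Lemma finite_box (n : nat) : finite_set (box n).
Proof.
pose f (ab : nat * nat) : int * int := (ab.1%:Z, ab.2%:Z).
apply: (@sub_finite_set _ _ (f @` (`I_n.+1 `*` `I_n.+1))); last first.
  by apply: finite_image; apply: finite_setX; apply: finite_II.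
move=> [[a|a] [b|b]] [] //= _ an _ bn.
by exists (a, b) => //; split; rewrite /= ltnS -lez_nat.
Qed.

(* [fset_set] is the empty set on infinite sets; this does not happen here,
   since [A `&` box n] is finite for every [A]. *)
Definition count_box (A : set (int * int)) (n : nat) : nat :=
  #|` fset_set (A `&` box n)|%N.

(* The lattice points on the real line a x + b y = c. *)
Definition lattice_line (R : realType) (a b c : R) : set (int * int) :=
  [set p | a * p.1%:~R + b * p.2%:~R = c].

Definition no_three_collinear (R : realType) (L : set (int * int)) : Prop :=
  forall p q r : int * int, L p -> L q -> L r ->
    p <> q -> p <> r -> q <> r ->
    ~ exists a b c : R, (a, b) <> (0, 0) /\
        [/\ lattice_line a b c p, lattice_line a b c q & lattice_line a b c r].

(* In the quotients below, x / 0 = 0; by unboundedness and monotonicity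
   k n > 0 for large n, so this affects no limit inferior. *)
Record sublinear_limiter (R : realType) (k : nat -> R) : Prop := {
  limiter_at0 : k 0%N = 0;
  limiter_ge0 : forall n : nat, 0 <= k n;
  limiter_sublinear : k =o_\oo (fun n : nat => n%:R : R);
  limiter_unbounded : ~ has_ubound (range k);
  limiter_nondecreasing : {homo k : m n / (m <= n)%N >-> m <= n};
  limiter_sum : (1%:E <= limn_einf (fun n : nat =>
    ((\sum_(1 <= i < n.+1) 2 * k i) / (n%:R * k n))%:E))%E;
  limiter_scale : forall lambda : R, 0 <= lambda <= 1 ->
    (lambda%:E <= limn_einf (fun n : nat =>
      (k (Num.truncn (lambda * n%:R)) / k n)%:E))%E
}.

(* Main.v *)
Require Import Defs.
From mathcomp Require Import all_boot all_order all_algebra.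
From mathcomp Require Import all_classical all_reals all_analysis.
From mathcomp Require Import finmap zify ring lra.

Import Order.TTheory GRing.Theory Num.Theory.
Import numFieldNormedType.Exports.
Local Open Scope classical_set_scope.
Local Open Scope ring_scope.

(** The set S is a union of horizontal translates of L, one translate L + (j, 0)
    for each j >= 1, where the j-th translate is kept only in the rows y with
    2 j <= k |y|.

    Lines. A translate of L still has at most two points on every line, and only
    the translates with j <= k(n) / 2 reach the box [1, n]^2. So a line
    contains at most 2 (k(n) / 2) <= k(n) points of S in the box
    ([layered_line_le]).

    Density. A row is itself a line, so it contains at most two points of L, and
    hence a given point lies in at most two of the translates: counting S loses at
    most a factor 2 against the sum of the sizes of its layers
    ([sum_layers_le]). Fix 0 < lambda < H and T = floor (lambda n). As k(n) = o(n),
    the shifts in use are negligible against n, so each translate has at least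
    2 T points in the box; the rows from which the j-th layer is missing are those
    with k(y) < 2 j, and each of them costs at most two points. So when
    2 j <= k(T) the j-th layer keeps at least 2 #{i <= T : 2 j <= k(i)} points
    ([count_layer_ge]). Exchanging the order of summation,

      2 |S| >= sum_j 2 #{i <= T : 2 j <= k(i)}
             = 2 sum_(i <= T) floor (k(i) / 2) >= sum_(i <= T) k(i) - 2 T

    ([layered_count_ge]). The averaging condition on k bounds sum_(i <= T) k(i)
    below by about T k(T) / 2, and the scaling condition bounds k(T) below by
    about lambda k(n); since k is unbounded, T = o(n k(n)). Altogether
    |S| >= (lambda^2 / 4 - o(1)) n k(n), and lambda may be taken arbitrarily
    close to H. *)

(** * Counting over finite sequences *)

Lemma double_count {T U : Type} (s : seq T) (t : seq U) (r : T -> U -> bool) :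
  (\sum_(x <- s) count (r x) t = \sum_(y <- t) count (r^~ y) s)%N.
Proof.
under eq_bigr do rewrite -sum1_count big_mkcond /=.
rewrite exchange_big /=; apply: eq_bigr => y _.
by rewrite -sum1_count [RHS]big_mkcond.
Qed.

(** A charging argument: the indices of [t] stand for the rows of a box, or for the
    translates of a set, each of which can take at most [b] of the points. *)
Lemma count_cover {T U : eqType} (a : pred T) (s : seq T) (t : seq U)
    (r : T -> U -> bool) (b : nat) :
  {in s, forall x, a x -> has (r x) t} ->
  {in t, forall y, (count (r^~ y) s <= b)%N} ->
  (count a s <= b * size t)%N.
Proof.
move=> cov fib; apply: (@leq_trans (\sum_(x <- s) count (r x) t)).
  rewrite -sum1_count big_mkcond /= big_seq [leqRHS]big_seq.
  apply: leq_sum => x xs; case: ifP => // ax.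
  by rewrite -has_count cov.
rewrite double_count -sum1_size big_distrr /= big_seq [leqRHS]big_seq.
by apply: leq_sum => y yt; rewrite muln1 fib.
Qed.

Lemma count_le2 {T : eqType} (a : pred T) (s : seq T) : uniq s ->
  (forall x y z, a x -> a y -> a z -> x <> y -> x <> z -> y <> z -> False) ->
  (count a s <= 2)%N.
Proof.
move=> us no3; rewrite -size_filter.
have := filter_uniq a us; have := filter_all a s.
case: (seq.filter a s) => [|x [|y [|z w]]] //=.
move=> /and4P[ax ay az _] /andP[xw /andP[yw _]]; exfalso.
by apply: (no3 x y z) => // e; subst; move: xw yw; rewrite !inE eqxx ?orbT.
Qed.

(** * Lattice points in a box *)

(** An explicit enumeration of the box turns every [count_box] into a [count]
    over one and the same sequence, where double counting applies. *)
Definition box_seq (n : nat) : seq (int * int) := enum_fset (fset_set (box n)).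

Lemma mem_box_seq n p : (p \in box_seq n) = `[< box n p >].
Proof. by rewrite -[LHS]/(p \in fset_set (box n)) in_fset_set//; exact: finite_box. Qed.

Lemma box_seq_uniq n : uniq (box_seq n).
Proof. exact: fset_uniq. Qed.

Lemma count_boxE A n : count_box A n = count (fun p => `[< A p >]) (box_seq n).
Proof.
rewrite /count_box -size_filter; apply/perm_size/uniq_perm.
- exact: fset_uniq.
- exact/filter_uniq/box_seq_uniq.
move=> p; rewrite mem_filter mem_box_seq.
rewrite -[LHS]/(p \in fset_set _) in_fset_set; last first.
  by apply: sub_finite_set (finite_box n) => x [].
apply/idP/idP => [/set_mem[Ap bp]|/andP[/asboolP Ap /asboolP bp]].
  by apply/andP; split; exact/asboolP.
by apply/mem_set; split.
Qed.

(** * Sets with no three collinear points *)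

Definition shift (L : set (int * int)) (j : nat) : set (int * int) :=
  [set p | L (p.1 - j%:Z, p.2)].

Lemma no_three_collinear_shift {R : realType} (L : set (int * int)) (j : nat) :
  no_three_collinear R L -> no_three_collinear R (shift L j).
Proof.
move=> hL x y z Lx Ly Lz xy xz yz [a [b [c [ab0 [lx ly lz]]]]].
have inj (u v : int * int) : u <> v -> (u.1 - j%:Z, u.2) <> (v.1 - j%:Z, v.2).
  by move=> uv [e1 e2]; apply: uv; move: u v e1 e2 => [? ?] [? ?] /= /addIr -> ->.
apply: (hL _ _ _ Lx Ly Lz (inj _ _ xy) (inj _ _ xz) (inj _ _ yz)).
(* Translating back by j turns the line a x + b y = c into a x + b y = c - a j. *)
exists a, b, (c - a * j%:R); split=> //.
by move: lx ly lz; rewrite /lattice_line /= => lx ly lz;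
  split; rewrite rmorphB /= mulrBr addrAC ?lx ?ly ?lz.
Qed.

Lemma count_line_le2 {R : realType} (L : set (int * int)) (n : nat) (a b c : R) :
  no_three_collinear R L -> (a, b) <> (0, 0) ->
  (count_box (L `&` lattice_line a b c) n <= 2)%N.
Proof.
move=> hL ab0; rewrite count_boxE; apply: count_le2 (box_seq_uniq n) _.
move=> x y z /asboolP[Lx lx] /asboolP[Ly ly] /asboolP[Lz lz] xy xz yz.
by apply: (hL _ _ _ Lx Ly Lz xy xz yz); exists a, b, c.
Qed.

Lemma count_row_le2 {R : realType} (L : set (int * int)) (n y : nat) :
  no_three_collinear R L ->
  (count (fun p => `[< L p /\ p.2 = y%:Z >]) (box_seq n) <= 2)%N.
Proof.
move=> hL; apply: leq_trans (@count_line_le2 R L n 0 1 y%:R hL _); last first.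
  by case=> /eqP; rewrite oner_eq0.
rewrite count_boxE; apply: sub_count => p /asboolP[Lp p2]; apply/asboolP.
by split=> //; rewrite /lattice_line /= mul0r mul1r add0r p2.
Qed.

Lemma box_row n p :
  box n p -> [/\ p.2 = `|p.2|%N%:Z, (0 < `|p.2|)%N & (`|p.2| <= n)%N].
Proof. by move: p => [x y] [] /= *; split; lia. Qed.

Lemma count_box_le {R : realType} (L : set (int * int)) (n : nat) :
  no_three_collinear R L -> (count_box L n <= 2 * n)%N.
Proof.
move=> hL; rewrite count_boxE -[n in leqRHS](size_iota 1).
apply: (@count_cover _ _ _ _ _ (fun p y => `[< L p /\ p.2 = y%:Z >])) => [p|y _].
  rewrite mem_box_seq => /asboolP /box_row[p2 p0 pn] /asboolP Lp.
  apply/hasP; exists `|p.2|%N; last exact/asboolP.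
  by rewrite mem_iota p0 add1n ltnS.
exact: count_row_le2 hL.
Qed.

(** * The layered set *)

Section construction.
Context {R : realType} (L : set (int * int)) (k : nat -> R).
Context (hL : no_three_collinear R L) (k_ge0 : forall n, 0 <= k n)
  (k_nd : {homo k : m n / (m <= n)%N >-> m <= n}).

(** The cut-off depends on the row only: this makes the box [1, n]^2 meet no
    layer beyond k(n) / 2, and what a layer loses can be counted row by row. *)
Definition layer (j : nat) : set (int * int) :=
  [set p | shift L j p /\ 2 * j%:R <= k `|p.2|%N].

Definition layered : set (int * int) :=
  [set p | exists2 j, (0 < j)%N & layer j p].

Lemma layer_le_half n p j : box n p -> layer j p -> (j <= Num.truncn (k n / 2))%N.
Proof.
move=> /box_row[_ _ pn] [_ kj].
rewrite truncn_ge_nat ?divr_ge0// ler_pdivlMr// mulrC.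
exact: le_trans kj (k_nd _ _ pn).
Qed.

(** Each of the at most k n / 2 translates that reach the box contributes at most
    two points of the line. *)
Lemma layered_line_le n (a b c : R) : (a, b) <> (0, 0) ->
  (count_box (layered `&` lattice_line a b c) n)%:R <= k n.
Proof.
move=> ab0; set J := Num.truncn (k n / 2).
apply: (@le_trans _ _ (2 * J)%:R); last first.
  by rewrite natrM mulrC -ler_pdivlMr// truncn_le divr_ge0.
rewrite ler_nat count_boxE -[J in leqRHS](size_iota 1).
apply: (@count_cover _ _ _ _ _ (fun p j =>
  `[< (shift L j `&` lattice_line a b c) p >])) => [p|j _]; last first.
  by rewrite -count_boxE count_line_le2//; exact: no_three_collinear_shift.
rewrite mem_box_seq => /asboolP pn /asboolP[[j j0 jp] lp].
apply/hasP; exists j; last by apply/asboolP; split=> //; case: jp.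
by rewrite mem_iota j0 add1n ltnS (layer_le_half _ _ _ pn jp).
Qed.

(** The layers through p correspond to the points p - (j, 0) of L, which all lie
    on one horizontal line. *)
Lemma layer_multiplicity_le2 (t : seq nat) p : uniq t ->
  (count (fun j => `[< layer j p >]) t <= 2)%N.
Proof.
move=> ut; apply: count_le2 ut _ => x y z /asboolP[Lx _] /asboolP[Ly _] /asboolP[Lz _].
have inj (i j : nat) : i <> j -> (p.1 - i%:Z, p.2) <> (p.1 - j%:Z, p.2).
  by move=> ij []; lia.
move=> xy xz yz; apply: (hL _ _ _ Lx Ly Lz (inj _ _ xy) (inj _ _ xz) (inj _ _ yz)).
exists 0, 1, p.2%:~R; split; first by case=> /eqP; rewrite oner_eq0.
by split; rewrite /lattice_line /= mul0r mul1r add0r.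
Qed.

Lemma sum_layers_le n J :
  (\sum_(j <- iota 1 J) count_box (layer j) n <= 2 * count_box layered n)%N.
Proof.
under eq_bigr do rewrite count_boxE.
rewrite double_count count_boxE -sum1_count big_distrr /= [leqRHS]big_mkcond /=.
apply: leq_sum => p _; case: ifPn => [_|np].
  by rewrite muln1 layer_multiplicity_le2// iota_uniq.
rewrite leqn0; apply/eqP/eqP; rewrite -leqn0 leqNgt -has_count.
apply/hasP => -[j]; rewrite mem_iota => /andP[j0 _] /asboolP jp.
by move/asboolP: np; apply; exists j.
Qed.

(** Translation by (j, 0) sends the box of side n - j into the box of side n. *)
Lemma count_shift_ge j n : (count_box L (n - j) <= count_box (shift L j) n)%N.
Proof.
pose f (p : int * int) : int * int := (p.1 + j%:Z, p.2).
have f_inj : injective f by move=> [? ?] [? ?] [/addIr -> ->].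
rewrite !count_boxE -!size_filter -(size_map f).
apply: uniq_leq_size; first by rewrite map_inj_uniq// filter_uniq// box_seq_uniq.
move=> q /mapP[[x y]]; rewrite mem_filter mem_box_seq => /andP[/asboolP Lp /asboolP bp] ->.
rewrite mem_filter mem_box_seq; apply/andP; split; apply/asboolP.
  by rewrite /shift /f /= addrK.
by move: bp; rewrite /box /f /= => -[? ? ? ?]; split; lia.
Qed.

(** The translate has at least 2 T points in the box, and it loses at most two
    in each row y with k y < 2 j. By monotonicity all these rows satisfy y <= T, so
    the loss is at most twice the number of such i in [1, T]. *)
Lemma count_layer_ge j n T : 2 * j%:R <= k T -> (2 * T <= count_box L (n - j))%N ->
  (2 * count (fun i => 2 * j%:R <= k i)%R (iota 1 T) <= count_box (layer j) n)%N.
Proof.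
move=> jT /leq_trans /(_ (count_shift_ge j n)); rewrite !count_boxE.
set A := count _ (box_seq n); set B := count _ (iota 1 T); set C := count _ _.
suff AC : (A <= C + 2 * count (predC (fun i => 2 * j%:R <= k i)%R) (iota 1 T))%N.
  have := count_predC (fun i : nat => 2 * j%:R <= k i) (iota 1 T).
  by rewrite size_iota -/B; lia.
(* E singles out the points of the translate that the cut-off removes. *)
pose E (p : int * int) := `[< shift L j p /\ ~~ (2 * j%:R <= k `|p.2|%N) >].
apply: (@leq_trans (C + count E (box_seq n))).
  rewrite -count_predUI; apply: leq_trans (leq_addr _ _).
  apply: sub_count => p /asboolP Lp; rewrite /= /E.
  have [kp|kp] := boolP (2 * j%:R <= k `|p.2|%N); apply/orP; [left|right]; exact/asboolP.
rewrite leq_add2l -[in leqRHS]size_filter.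
apply: (@count_cover _ _ _ _ _ (fun p y => `[< shift L j p /\ p.2 = y%:Z >])).
  move=> p; rewrite mem_box_seq => /asboolP /box_row[p2 p0 _] /asboolP[Lp kp].
  apply/hasP; exists `|p.2|%N; last exact/asboolP.
  rewrite mem_filter /= kp mem_iota p0 add1n ltnS /=.
  by rewrite leqNgt; apply: contra kp => Tp; rewrite (le_trans jT)// k_nd// ltnW.
by move=> y _; exact: count_row_le2 (no_three_collinear_shift _ _ hL).
Qed.

(** The indices counted are exactly 1, ..., floor (k i / 2). *)
Lemma count_half_ge i J : (Num.truncn (k i / 2) <= J)%N ->
  k i / 2 - 1 <= (count (fun j : nat => 2 * j%:R <= k i) (iota 1 J))%:R.
Proof.
set q := Num.truncn _ => qJ.
have /andP[_ /ltW kq] : q%:R <= k i / 2 < q.+1%:R by rewrite truncn_itv// divr_ge0.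
rewrite lerBlDr (le_trans kq)// -natr1 lerD2r ler_nat.
rewrite -(subnKC qJ) iotaD count_cat; apply: leq_trans (leq_addr _ _).
rewrite -[leqLHS](size_iota 1) leq_eqVlt eq_sym -all_count; apply/orP; left.
apply/allP => j; rewrite mem_iota add1n ltnS => /andP[_ jq].
by rewrite mulrC -ler_pdivlMr// -truncn_ge_nat ?divr_ge0.
Qed.

(** Non-asymptotic form of the density bound: the layers j <= k T / 2 are
    counted with [count_layer_ge], and the double sum over pairs (j, i) with
    2 j <= k i is evaluated by summing over j first. *)
Lemma layered_count_ge n T :
  (forall j : nat, 2 * j%:R <= k T -> (2 * T <= count_box L (n - j))%N) ->
  (\sum_(1 <= i < T.+1) k i) / 2 - T%:R <= (count_box layered n)%:R.
Proof.
move=> hT; set J := Num.truncn (k T / 2).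
have jT j : j \in iota 1 J -> 2 * j%:R <= k T.
  rewrite mem_iota add1n ltnS => /andP[_].
  by rewrite truncn_ge_nat ?divr_ge0// ler_pdivlMr// mulrC.
have : (\sum_(j <- iota 1 J) 2 * count (fun i : nat => 2 * j%:R <= k i)%R (iota 1 T)
        <= 2 * count_box layered n)%N.
  apply: leq_trans (sum_layers_le n J).
  rewrite big_seq [leqRHS]big_seq; apply: leq_sum => j /jT kj.
  by apply: count_layer_ge => //; exact: hT.
rewrite -big_distrr leq_pmul2l// double_count => h.
apply: (@le_trans _ _ (\sum_(i <- iota 1 T)
   count (fun j : nat => 2 * j%:R <= k i)%R (iota 1 J))%:R); last by rewrite ler_nat.
rewrite natr_sum /index_iota subSS subn0.
apply: (@le_trans _ _ (\sum_(i <- iota 1 T) (k i / 2 - 1))).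
  by rewrite sumrB -mulr_suml -[in T%:R](size_iota 1 T) -sum1_size natr_sum.
rewrite big_seq [leRHS]big_seq; apply: ler_sum => i.
rewrite mem_iota add1n ltnS => /andP[_ iT].
apply: count_half_ge; apply: le_truncn.
by rewrite ler_pM2r// k_nd.
Qed.

End construction.

(** * Limits inferior and limiter functions *)

Lemma le_limn_einfP {R : realType} (u : nat -> R) (l : R) :
  (l%:E <= limn_einf (fun n => (u n)%:E))%E <->
  forall e, 0 < e -> \forall n \near \oo, l - e <= u n.
Proof.
have -> : limn_einf (fun n => (u n)%:E) =
    ereal_sup (range (einfs (fun n => (u n)%:E))).
  by rewrite limn_einf_lim; apply/cvg_lim => //; exact: cvg_einfs_sup.
split=> [lu e e0|lu].
  have : ((l - e)%:E < ereal_sup (range (einfs (fun n => (u n)%:E))))%E.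
    by apply: lt_le_trans lu; rewrite lte_fin ltrBlDr ltrDl.
  move=> /ereal_sup_gt[_ [N _ <-]] /ltW hN; exists N => // n /= Nn.
  by rewrite -lee_fin (le_trans hN)// ereal_inf_lbound//; exists n.
apply/lee_subgt0Pr => e /lu[N _ hN].
apply: (@le_trans _ _ (einfs (fun n => (u n)%:E) N)); last first.
  by apply: ereal_sup_ubound; exists N.
by apply: le_ereal_inf_tmp => _ [n Nn <-]; rewrite -EFinB lee_fin hN.
Qed.

Lemma cvg_truncn_scale {R : realType} (lam : R) : 0 < lam ->
  (fun n : nat => Num.truncn (lam * n%:R)) @ \oo --> \oo.
Proof.
move=> lam0; apply/cvgnyPge => N; near=> n.
rewrite truncn_ge_nat ?mulr_ge0 ?(ltW lam0)// mulrC -ler_pdivrMr//.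
by near: n; exact: nbhs_infty_ger.
Unshelve. all: by end_near. Qed.

Section limiter.
Context {R : realType} {k : nat -> R} (hk : sublinear_limiter k).

Lemma limiter_cvgy : k n @[n --> \oo] --> +oo.
Proof.
apply/cvgryPge => A; apply: contrapT => nA.
apply: (limiter_unbounded hk); exists A => _ [m _ <-].
rewrite leNgt; apply/negP => /ltW Am; apply: nA.
near=> n; apply: le_trans Am _; apply: (limiter_nondecreasing hk).
by near: n; exact: nbhs_infty_ge.
Unshelve. all: by end_near. Qed.

Lemma limiter_le_small (e : R) : 0 < e -> \forall n \near \oo, k n <= e * n%:R.
Proof.
move=> e0; have /eqoP/(_ e e0) := limiter_sublinear hk.
apply: filterS => n; rewrite (ger0_norm (limiter_ge0 hk n)).
by rewrite (@ger0_norm _ (n%:R : R)).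
Qed.
End limiter.

(** * Asymptotic estimates *)

(** The proof of the density bound takes lambda = H - eta and ends up with the
    constant on the right below, whose limit as eta tends to 0 is H^2 / 4. *)
Lemma limit_constant_bound {R : realType} (H e : R) : 0 < H -> H <= 1 ->
  0 < e -> exists2 eta, 0 < eta & 2 * eta < H /\
    H ^+ 2 / 4 - e <= (1 - eta) / 4 * (H - 2 * eta) ^+ 2 - eta.
Proof.
move=> H0 H1 e0.
(* For H <= 1 the right-hand side is at least H ^+ 2 / 4 - 3 * eta, whence e / 3;
   the bound H / 3 gives 2 * eta < H. *)
exists (Num.min (e / 3) (H / 3)).
  by rewrite lt_min !divr_gt0.
set eta := Num.min _ _.
have [h1 h2] : eta <= e / 3 /\ eta <= H / 3 by rewrite !ge_min !lexx orbT.
have h0 : 0 < eta by rewrite lt_min !divr_gt0.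
split; first lra.
have : 0 <= eta * (1 - H) by rewrite mulr_ge0//; lra.
have : 0 <= (1-eta) * eta ^+ 2 by rewrite mulr_ge0 ?sqr_ge0//; lra.
have : 0 <= H * eta ^+ 2 by rewrite mulr_ge0 ?sqr_ge0//; lra.
have : 0 <= eta * (1 - H ^+2) by rewrite mulr_ge0 ?subr_ge0 ?expr_le1//; lra.
nra.
Qed.

(** Each of the n rows of the box has at most two points of L. This is what
    allows [limiter_scale] to be applied to every lambda < H. *)
Lemma liminf_count_box_le1 {R : realType} {L : set (int * int)} {H : R} :
  no_three_collinear R L ->
  (H%:E <= limn_einf (fun n : nat => ((count_box L n)%:R / (2 * n%:R) : R)%:E))%E ->
  H <= 1.
Proof.
move=> hL hH; rewrite leNgt; apply/negP => H1.
have e0 : 0 < (H - 1) / 2 by rewrite divr_gt0 ?subr_gt0.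
have [N _ hN] := (le_limn_einfP _ _).1 hH _ e0.
have := hN N.+1 (leqnSn N); rewrite leNgt => /negP; apply.
apply: (@le_lt_trans _ _ 1); last lra.
by rewrite ler_pdivrMr ?mulr_gt0// mul1r -natrM ler_nat (count_box_le _ _ hL).
Qed.

(** The shifts in use are so small that a translate still has 2 T points in the
    box: n - j >= (1 - eta / 4) n, and
    (H - eta / 2) (1 - eta / 4) >= H - eta because H <= 1. *)
Lemma count_box_shifted_ge {R : realType} (L : set (int * int)) (H eta : R)
    (N n j T : nat) :
  (forall m, (N <= m)%N -> H - eta / 2 <= (count_box L m)%:R / (2 * m%:R)) ->
  0 < eta -> 2 * eta < H -> H <= 1 -> N.+1%:R * 2 <= n%:R :> R ->
  T%:R <= (H - eta) * n%:R -> 2 * j%:R <= eta / 2 * n%:R ->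
  (2 * T <= count_box L (n - j))%N.
Proof.
move=> hN eta0 etaH H1 n_large T_le j_le.
have j_half : 2 * j%:R <= n%:R :> R.
  by rewrite (le_trans j_le)// ler_piMl//; lra.
have j0 : 0 <= j%:R :> R by [].
have j_le_n : (j <= n)%N by rewrite -(ler_nat R); move: j0 j_half; clear; lra.
have m_large : (N < n - j)%N by rewrite -(ler_nat R) natrB//; lra.
have m0 : 0 < (n - j)%:R :> R by rewrite ltr0n (leq_ltn_trans _ m_large).
have := hN _ (ltnW m_large); rewrite ler_pdivlMr ?mulr_gt0// => hm.
rewrite -(ler_nat R) (le_trans _ hm)// natrM mulrCA ler_pM2l// (le_trans T_le)//.
rewrite natrB//.
have h1 : 0 <= eta * (1 - H) * n%:R by rewrite !mulr_ge0//; lra.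
have h2 : 0 <= (H - eta / 2) * (eta / 2 * n%:R - 2 * j%:R) by rewrite mulr_ge0//; lra.
have h3 : 0 <= eta ^+ 2 * n%:R by rewrite mulr_ge0// sqr_ge0.
have h4 : 0 <= eta * n%:R by rewrite mulr_ge0// ltW.
by move: h1 h2 h3 h4; clear; lra.
Qed.

(** Applied with mu = H - 2 eta, a common lower bound for T / n and k(T) / k(n):
    T kT >= mu^2 n kn, while T <= n <= eta n kn is an error term. *)
Lemma density_estimate {R : realType} (mu eta n kn T kT sumk C : R) :
  0 <= mu -> eta <= 1 -> 0 <= n -> 0 <= kn -> 1 <= eta * kn ->
  mu * n <= T -> T <= n -> mu * kn <= kT ->
  (1 - eta) * (T * kT) <= 2 * sumk -> sumk / 2 - T <= C ->
  ((1 - eta) / 4 * mu ^+ 2 - eta) * (n * kn) <= C.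
Proof.
move=> mu0 eta1 n0 kn0 eta_kn T_ge T_le kT_ge sum_ge C_ge.
have TkT : mu ^+ 2 * (n * kn) <= T * kT.
  by rewrite expr2 mulrACA; apply: ler_pM => //; exact: mulr_ge0.
have Tn : T <= eta * (n * kn).
  by rewrite mulrCA (le_trans T_le)// ler_peMr.
have : (1 - eta) * (mu ^+ 2 * (n * kn)) <= (1 - eta) * (T * kT).
  by rewrite ler_wpM2l//; lra.
by move: Tn sum_ge C_ge; clear; lra.
Qed.

Theorem theorem4p3 (R : realType) (L : set (int * int)) (H : R)
    (hL : no_three_collinear R L)
    (hH : limn_einf (fun n : nat => ((count_box L n)%:R / (2 * n%:R) : R)%:E)
          = H%:E)
    (H_gt0 : 0 < H)
    (k : nat -> R) (hk : sublinear_limiter k) :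
  exists S : set (int * int),
    (forall n : nat, (0 < n)%N ->
      forall a b c : R, (a, b) <> (0, 0) ->
        (count_box (S `&` lattice_line a b c) n)%:R <= k n) /\
    ((H ^+ 2 / 4)%:E <=
      limn_einf (fun n : nat =>
        ((count_box S n)%:R / (n%:R * k n) : R)%:E))%E.
Proof.
have k_ge0 := limiter_ge0 hk; have k_nd := limiter_nondecreasing hk.
have {}hH : (H%:E <= limn_einf
    (fun n : nat => ((count_box L n)%:R / (2 * n%:R) : R)%:E))%E by rewrite hH.
have H_le1 := liminf_count_box_le1 hL hH.
exists (layered L k); split=> [n _ a b c|]; first exact: layered_line_le.
apply/le_limn_einfP => e e0.
have [eta eta0 [etaH he]] := limit_constant_bound H e H_gt0 H_le1 e0.
have d0 : 0 < eta / 2 by rewrite divr_gt0.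
have [N _ hN] := (le_limn_einfP _ _).1 hH _ d0.
have lam0 : 0 < H - eta by lra.
have lam_le1 : H - eta <= 1 by lra.
have eta_le1 : eta <= 1 by lra.
have mu0 : 0 < H - 2 * eta by lra.
near=> n.
set T := Num.truncn ((H - eta) * n%:R).
(* The factor 2 ensures that n - j is still beyond N, since 2 * j <= n. *)
have n_large : N.+1%:R * 2 <= n%:R :> R by near: n; exact: nbhs_infty_ger.
have n0 : 0 < n%:R :> R by apply: lt_le_trans n_large; rewrite mulr_gt0.
have eta_n : 1 <= eta * n%:R.
  rewrite mulrC -ler_pdivrMr//; near: n; exact: nbhs_infty_ger.
have k_small : k n <= eta / 2 * n%:R by near: n; exact: limiter_le_small.
have eta_k : 1 <= eta * k n.
  rewrite mulrC -ler_pdivrMr//; near: n.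
  exact: (cvgryPge _).1 (limiter_cvgy hk) _.
have kn0 : 0 < k n by rewrite -(pmulr_rgt0 _ eta0) (lt_le_trans _ eta_k).
have kT : (H - 2 * eta) * k n <= k T.
  rewrite -ler_pdivlMr// (_ : H - 2 * eta = H - eta - eta); last by ring.
  rewrite /T; near: n.
  have lam01 : 0 <= H - eta <= 1 by rewrite ltW.
  exact: (le_limn_einfP _ _).1 (limiter_scale hk lam01) _ eta0.
have /andP[T_le T_gt] : T%:R <= (H - eta) * n%:R < T.+1%:R.
  by rewrite truncn_itv// mulr_ge0// ltW.
(* The factor H - 2 * eta leaves room for the rounding in T. *)
have T_ge : (H - 2 * eta) * n%:R <= T%:R by move: T_gt eta_n; rewrite -natr1; clear; lra.
have T0 : 0 < T%:R :> R by apply: lt_le_trans T_ge; rewrite mulr_gt0.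
have kT0 : 0 < k T by apply: lt_le_trans kT; rewrite mulr_gt0.
have sumk : (1 - eta) * (T%:R * k T) <= 2 * \sum_(1 <= i < T.+1) k i.
  rewrite mulr_sumr -ler_pdivlMr ?mulr_gt0//; rewrite /T; near: n.
  have hsum := (le_limn_einfP _ _).1 (limiter_sum hk) _ eta0.
  exact: (cvg_truncn_scale _ lam0 _ hsum).
have T_le_n : T%:R <= n%:R :> R.
  by apply: le_trans T_le _; rewrite ler_piMl.
apply: le_trans he _; rewrite ler_pdivlMr ?mulr_gt0//.
apply: (density_estimate _ _ _ _ _ _ _ _ (ltW mu0) eta_le1 (ltW n0) (ltW kn0) eta_k
  T_ge T_le_n kT sumk).
apply: (layered_count_ge _ _ hL k_ge0 k_nd) => j jT.
apply: (count_box_shifted_ge _ _ _ _ _ _ _ hN eta0 etaH H_le1 n_large T_le).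
by rewrite (le_trans jT)// (le_trans _ k_small)// k_nd// -(ler_nat R).
Unshelve. all: by end_near. Qed.
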